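(* Let $n,m\ge 1$ be integers and let $P^m:\mathcal{S}(\mathbb{R}^n,\mathbb{C})\to\mathcal{S}(\mathbb{R}^n,\mathbb{C})$ be the power operator $P^m(f)=f^m$ (pointwise power). Then $P^m$ is Fréchet differentiable on $\mathcal{S}(\mathbb{R}^n,\mathbb{C})$, and for every $\bar f\in\mathcal{S}(\mathbb{R}^n,\mathbb{C})$ its Fréchet derivative at $\bar f$ is given as follows. (i) If $m=1$, then $\nabla P^1(\bar f)(u)=u$ for every $u\in\mathcal{S}(\mathbb{R}^n,\mathbb{C})$. (ii) If $m>1$, then: (a) if $\bar f\equiv\theta_{\mathcal{S}}$, $\nabla P^m(\theta_{\mathcal{S}})(u)\equiv\theta_{\mathcal{S}}$ for every $u\in\mathcal{S}(\mathbb{R}^n,\mathbb{C})$; (b) if $\bar f\not\equiv\theta_{\mathcal{S}}$, $\nabla P^m(\bar f)(u)=m\bar f^{\,m-1}u$ for every $u\in\mathcal{S}(\mathbb{R}^n,\mathbb{C})$, i.e. $\nabla P^m(\bar f)(u)(x)=m\bar f^{\,m-1}(x)u(x)$ for every $x\in\mathbb{R}^n$.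
   Context: $\mathbb{N}$ is the set of nonnegative integers. $\mathcal{S}(\mathbb{R}^n,\mathbb{C})$ is the Schwartz space of all $f\in C^\infty(\mathbb{R}^n,\mathbb{C})$ with $\|f\|_{\alpha,\beta}:=\sup_{x\in\mathbb{R}^n}|x^\alpha(D^\beta f)(x)|<\infty$ for all multi-indices $\alpha,\beta\in\mathbb{N}^n$; its origin is $\theta_{\mathcal{S}}$, and its topology $\tau_{\mathcal{S}}$ is induced by the family of seminorms $\mathbb{F}_{\mathcal{S}}=\{\|\cdot\|_{\alpha,\beta}:\alpha,\beta\in\mathbb{N}^n\}$. $\mathcal{F}_{\mathcal{S}}$ denotes the collection of nonempty finite subsets of $\mathbb{F}_{\mathcal{S}}$. Fréchet differentiability here is with respect to the family $\mathbb{F}_{\mathcal{S}}$: for $T:\mathcal{S}(\mathbb{R}^n,\mathbb{C})\to\mathcal{S}(\mathbb{R}^n,\mathbb{C})$ and $\bar f\in\mathcal{S}(\mathbb{R}^n,\mathbb{C})$, $T$ is Fréchet differentiable at $\bar f$ with Fréchet derivative $\nabla T(\bar f)=A$ if $A:\mathcal{S}(\mathbb{R}^n,\mathbb{C})\to\mathcal{S}(\mathbb{R}^n,\mathbb{C})$ is a continuous linear mapping such that for every $J\in\mathcal{F}_{\mathcal{S}}$ and $\varepsilon>0$ there are $I\in\mathcal{F}_{\mathcal{S}}$ and $\delta>0$ such that for all $u\in\mathcal{S}(\mathbb{R}^n,\mathbb{C})$: (DZ) if $\max\{p(u):p\in I\}=0$ then $\max\{q(T(\bar f+u)-T(\bar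 f)-A(u)):q\in J\}=0$; and (DR) if $0<\max\{p(u):p\in I\}<\delta$ then $\max\left\{q\left(\frac{T(\bar f+u)-T(\bar f)-A(u)}{\max\{p(u):p\in I\}}\right):q\in J\right\}<\varepsilon$. The equation $\nabla T(\bar f)=A$ is the assertion that $A$ has these properties. *)

(* Defs.v *)
From HB Require Import structures.
From mathcomp Require Import all_boot all_order all_algebra.
From mathcomp Require Import finmap.
From mathcomp Require Import all_classical all_reals all_analysis.
From mathcomp Require Import complex.

Set Implicit Arguments.
Unset Strict Implicit.
Unset Printing Implicit Defensive.

Import Order.TTheory GRing.Theory Num.Theory.
Import numFieldNormedType.Exports.

Local Open Scope classical_set_scope.
Local Open Scope ring_scope.
Local Open Scope complex_scope.

(* [Rcomplex R] is the type [R[i]] seen as a real vector space, with the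
   R-valued modulus as its norm.  Limits and derivatives of complex-valued
   functions of real variables are taken there. *)

Lemma Rcomplex_normrZ (R : realType) (l : R) (z : Rcomplex R) :
  `|l *: z| = `|l| * `|z|.
Proof.
case: z => a b; rewrite /Num.norm /= !exprMn -mulrDr sqrtrM ?sqr_ge0//.
by rewrite sqrtr_sqr.
Qed.

Lemma Rcomplex_normrM (R : realType) (z w : Rcomplex R) :
  `|z * w : Rcomplex R| = `|z| * `|w|.
Proof. exact: Normc.normcM. Qed.

HB.instance Definition _ (R : realType) :=
  PseudoMetric.copy (Rcomplex R) (pseudoMetric_normed (Rcomplex R)).
HB.instance Definition _ (R : realType) := isPointed.Build (Rcomplex R) 0.
HB.instance Definition _ (R : realType) :=
  NormedZmod_PseudoMetric_eq.Build R (Rcomplex R) erefl.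
HB.instance Definition _ (R : realType) :=
  PseudoMetricNormedZmod_Lmodule_isNormedModule.Build R (Rcomplex R)
    (@Rcomplex_normrZ R).

Section Calculus.
Context {R : realType} {n : nat}.
Implicit Types (f g : 'rV[R]_n -> Rcomplex R) (j : 'I_n) (s : seq 'I_n).

Definition partial j f : 'rV[R]_n -> Rcomplex R := 'D_(delta_mx 0 j) f.

Definition partials s f : 'rV[R]_n -> Rcomplex R := foldr partial f s.

Definition smooth f := forall s,
  continuous (partials s f) /\
  forall j x, derivable (partials s f) x (delta_mx 0 j).

(* The multi-index (b_0, ..., b_(n-1)) as the word 0^b_0 1^b_1 ... *)
Definition mindex_word (b : {ffun 'I_n -> nat}) : seq 'I_n :=
  flatten [seq nseq (b j) j | j <- enum 'I_n].

Definition Dmulti (b : {ffun 'I_n -> nat}) f := partials (mindex_word b) f.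

Definition monomial (a : {ffun 'I_n -> nat}) (x : 'rV[R]_n) : R :=
  \prod_j x 0 j ^+ a j.



End Calculus.

Section ProductRule.
Context {R : realType}.

Lemma Rcomplex_cvgM (T : Type) (F : set_system T) (FF : Filter F)
    (u v : T -> Rcomplex R) (a b : Rcomplex R) :
  u @ F --> a -> v @ F --> b ->
  (fun t => u t * v t : Rcomplex R) @ F --> (a * b : Rcomplex R).
Proof.
move=> ua vb; apply/subr_cvg0/norm_cvg0P.
have lim0 : (fun t => `|u t - a| * `|v t| + `|a| * `|v t - b| : R) @ F --> (0 : R).
  rewrite -[0](_ : 0 * `|b| + `|a| * 0 = _ :> R); last first.
    by rewrite mul0r mulr0 addr0.
  apply: cvgD; apply: cvgM; [|exact: cvg_norm|exact: cvg_cst|].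
  - by apply/norm_cvg0P/subr_cvg0.
  - by apply/norm_cvg0P/subr_cvg0.
apply: (@squeeze_cvgr _ F FF R (fun=> 0) _ _ _ 0 _ lim0); last exact: cvg_cst.
apply: nearW => t; rewrite normr_ge0 /=.
rewrite -!Rcomplex_normrM.
have -> : (u t * v t - a * b : Rcomplex R) =
  ((u t - a : Rcomplex R) * v t + a * (v t - b : Rcomplex R) : Rcomplex R).
  by rewrite mulrBl mulrBr addrA subrK.
exact: (@ler_normD R (Rcomplex R)).
Qed.

Lemma Rcomplex_continuousM (T : topologicalType) (f g : T -> Rcomplex R) :
  continuous f -> continuous g ->
  continuous (fun x => f x * g x : Rcomplex R).
Proof. by move=> cf cg x; apply: Rcomplex_cvgM; [exact: cf|exact: cg]. Qed.

Lemma Rcomplex_is_deriveM (V : normedModType R) (f g : V -> Rcomplex R)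
    (x v : V) (df dg : Rcomplex R) :
  is_derive x v f df -> is_derive x v g dg ->
  is_derive x v (fun y => f y * g y : Rcomplex R)
    (df * g x + f x * dg : Rcomplex R).
Proof.
move=> [fd <-] [gd <-].
suff cv : (fun h => h^-1 *: (((fun y => f y * g y : Rcomplex R) \o shift x) (h *: v)
      - (f x * g x : Rcomplex R))) @ 0^' -->
    ('D_v f x * g x + f x * 'D_v g x : Rcomplex R).
  by split; [apply/cvg_ex; exists ('D_v f x * g x + f x * 'D_v g x : Rcomplex R)
            |exact: cvg_lim cv].
evar (G : R -> Rcomplex R); rewrite [X in X @ _](_ : _ = G); last first.
  apply/funext => h /=.
  have -> : (f (h *: v + x) * g (h *: v + x) - f x * g x : Rcomplex R) =
    ((f (h *: v + x) - f x : Rcomplex R) * g (h *: v + x) +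
      f x * (g (h *: v + x) - g x : Rcomplex R) : Rcomplex R).
    by rewrite mulrBl mulrBr addrA subrK.
  have scAr (k : R) (z w : Rcomplex R) :
      k *: (z * w : Rcomplex R) = z * (k *: w : Rcomplex R) :> Rcomplex R.
    by rewrite mulrC scalerAl mulrC.
  rewrite scalerDr scalerAl scAr /G; reflexivity.
rewrite {}/G; apply: cvgD; apply: Rcomplex_cvgM; [exact: fd| |exact: cvg_cst|exact: gd].
suff : {for 0, continuous (fun h : R => g (h *: v + x))}.
  by move=> /continuous_withinNx; rewrite scale0r add0r.
exact/differentiable_continuous/derivable1_diffP/(derivable1P _ _ _).1.
Qed.

End ProductRule.

Section Leibniz.
Context {R : realType} {n : nat}.
Implicit Types (f g : 'rV[R]_n -> Rcomplex R) (j : 'I_n) (s : seq 'I_n).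

Lemma smooth_is_derive s f j x : smooth f ->
  is_derive x (delta_mx 0 j) (partials s f) (partials (j :: s) f x).
Proof. by move=> /(_ s)[_ df]; split; [exact: df|]. Qed.

Lemma partialE j f (df : 'rV[R]_n -> Rcomplex R) :
  (forall x, is_derive x (delta_mx 0 j) f (df x)) -> partial j f = df.
Proof. by move=> fdf; apply/funext => x; exact: (@derive_val _ _ _ _ _ _ _ (fdf x)). Qed.

Lemma is_derive_big_sum (L : seq (seq 'I_n * seq 'I_n))
    (F G : seq 'I_n * seq 'I_n -> 'rV[R]_n -> Rcomplex R) x v :
  (forall p, is_derive x v (F p) (G p x)) ->
  is_derive x v (fun y => \sum_(p <- L) F p y) (\sum_(p <- L) G p x).
Proof.
move=> dF; elim: L => [|p L IH].
  rewrite big_nil.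
  have -> : (fun y => \sum_(p <- [::]) F p y) = cst 0.
    by apply/funext => y; rewrite big_nil.
  exact: is_derive_cst.
rewrite big_cons.
have -> : (fun y => \sum_(p <- p :: L) F p y) =
    F p + (fun y => \sum_(p <- L) F p y).
  by apply/funext => y; rewrite big_cons.
have dFp := dF p; exact: is_deriveD.
Qed.

Lemma continuous_big_sum (L : seq (seq 'I_n * seq 'I_n))
    (F : seq 'I_n * seq 'I_n -> 'rV[R]_n -> Rcomplex R) :
  (forall p, continuous (F p)) -> continuous (fun y => \sum_(p <- L) F p y).
Proof.
move=> cF; elim: L => [|p L IH].
  have -> : (fun y => \sum_(p <- [::]) F p y) = cst 0.
    by apply/funext => y; rewrite big_nil.
  exact: cst_continuous.
have -> : (fun y => \sum_(p <- p :: L) F p y) =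
    (fun y => F p y + \sum_(p <- L) F p y).
  by apply/funext => y; rewrite big_cons.
by move=> x; exact: (cvgD (cF p x) (IH x)).
Qed.

(* The derivatives falling on either factor are taken along subwords of [s]. *)
Lemma partialsM s f g : smooth f -> smooth g ->
  exists2 L : seq (seq 'I_n * seq 'I_n),
    all (fun p => subseq p.1 s && subseq p.2 s) L &
    partials s (fun x => f x * g x : Rcomplex R) =
    fun x => \sum_(p <- L) (partials p.1 f x * partials p.2 g x : Rcomplex R).
Proof.
move=> sf sg; elim: s => [|j s [L Ls IH]].
  by exists [:: ([::], [::])] => //; apply/funext => x; rewrite big_seq1.
exists ([seq (j :: p.1, p.2) | p <- L] ++ [seq (p.1, j :: p.2) | p <- L]).
  rewrite all_cat !all_map; apply/andP; split; apply: sub_all Ls => p /=.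
    case/andP => p1 p2; rewrite eqxx p1 /=.
    exact: subseq_trans p2 (subseq_cons _ _).
  case/andP => p1 p2; rewrite eqxx p2 andbT.
  exact: subseq_trans p1 (subseq_cons _ _).
rewrite [LHS]/= -/(partials s _) IH; apply: partialE => x.
have <- : \sum_(p <- L) (partials (j :: p.1) f x * partials p.2 g x +
    partials p.1 f x * partials (j :: p.2) g x : Rcomplex R) =
  \sum_(p <- [seq (j :: p.1, p.2) | p <- L] ++ [seq (p.1, j :: p.2) | p <- L])
    (partials p.1 f x * partials p.2 g x : Rcomplex R).
  by rewrite big_cat !big_map big_split.
apply: (@is_derive_big_sum L _ (fun p y => (partials (j :: p.1) f y *
  partials p.2 g y + partials p.1 f y * partials (j :: p.2) g y : Rcomplex R))).
by move=> p; apply: Rcomplex_is_deriveM; exact: smooth_is_derive.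
Qed.

Lemma smoothM f g : smooth f -> smooth g ->
  smooth (fun x => f x * g x : Rcomplex R).
Proof.
move=> sf sg s; have [L _ ->] := partialsM s sf sg; split.
  apply: continuous_big_sum => p; apply: Rcomplex_continuousM.
    by have [] := sf p.1.
  by have [] := sg p.2.
move=> j x.
have [] := @is_derive_big_sum L
  (fun p y => (partials p.1 f y * partials p.2 g y : Rcomplex R))
  (fun p y => (partials (j :: p.1) f y * partials p.2 g y +
    partials p.1 f y * partials (j :: p.2) g y : Rcomplex R)) x (delta_mx 0 j).
  by move=> p; apply: Rcomplex_is_deriveM; exact: smooth_is_derive.
by [].
Qed.

Lemma partialsD s f g : smooth f -> smooth g ->
  partials s (fun x => f x + g x) = fun x => partials s f x + partials s g x.
Proof.
move=> sf sg; elim: s => [//|j s IH].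
rewrite [LHS]/= -/(partials s _) IH; apply: partialE => x.
by apply: is_deriveD; exact: smooth_is_derive.
Qed.

Lemma smoothD f g : smooth f -> smooth g -> smooth (fun x => f x + g x).
Proof.
move=> sf sg s; rewrite partialsD//; split.
  by move=> x; exact: (cvgD ((sf s).1 x) ((sg s).1 x)).
by move=> j x; apply: derivableD; [exact: (sf s).2|exact: (sg s).2].
Qed.

Lemma partials_cst s (c : Rcomplex R) :
  partials s (cst c : 'rV[R]_n -> Rcomplex R) = cst (if s is [::] then c else 0).
Proof.
elim: s => [//|j s IH]; rewrite [LHS]/= -/(partials s _) IH.
by apply: partialE => x; exact: is_derive_cst.
Qed.

Lemma smooth_cst (c : Rcomplex R) : smooth (cst c : 'rV[R]_n -> Rcomplex R).
Proof.
move=> s; rewrite partials_cst; split; first exact: cst_continuous.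
by move=> j x; exact: derivable_cst.
Qed.

Lemma sorted_mindex_word (b : {ffun 'I_n -> nat}) :
  sorted (fun i j : 'I_n => (i <= j)%N) (mindex_word b).
Proof.
rewrite /mindex_word.
have leT : transitive (fun i j : 'I_n => (i <= j)%N).
  by move=> ? ? ?; exact: leq_trans.
have : sorted (fun i j : 'I_n => (i <= j)%N) (enum 'I_n).
  have := iota_sorted 0 n; rewrite -val_enum_ord sorted_map.
  exact: sub_sorted.
rewrite !sorted_pairwise//; elim: (enum 'I_n) => [//|i s IH] /=.
case/andP => /allP is_ /IH{}IH; rewrite pairwise_cat IH andbT; apply/andP; split.
  apply/allrelP => k l /nseqP[-> _] /flatten_mapP[m ms /nseqP[-> _]].
  exact: is_.
by elim: (b i) => //= k ->; rewrite andbT; apply/allP => l /nseqP[->].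
Qed.

Lemma sorted_mindexP s : sorted (fun i j : 'I_n => (i <= j)%N) s ->
  s = mindex_word [ffun j => count_mem j s].
Proof.
move=> ss; apply: (sorted_eq _ _ ss (sorted_mindex_word _)).
- by move=> ? ? ?; exact: leq_trans.
- by move=> i j /anti_leq /val_inj.
apply/allP => i _ /=; apply/eqP; rewrite count_flatten -map_comp.
rewrite sumnE big_map big_enum /= (bigD1 i) //= big1 => [|j ji].
  by rewrite addn0 count_nseq /= eqxx mul1n ffunE.
by rewrite count_nseq /= (negbTE ji).
Qed.

End Leibniz.

Section SchwartzFunctions.
Context {R : realType} {n : nat}.
Implicit Types (f g : 'rV[R]_n -> Rcomplex R) (s : seq 'I_n).

Definition is_schwartz f : Prop := smooth f /\
  forall a b, has_ubound (range (fun x => `|monomial a x *: Dmulti b f x|)).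

Lemma is_schwartz_bound s f : sorted (fun i j : 'I_n => (i <= j)%N) s ->
  is_schwartz f -> forall a, exists2 M : R, 0 <= M &
  forall x, `|monomial a x *: partials s f x| <= M.
Proof.
move=> /sorted_mindexP -> [_ fb] a; have [M fM] := fb a [ffun j => count_mem j s].
exists (Num.max 0 M) => [|x]; first by rewrite le_max lexx.
by rewrite le_max; apply/orP; right; apply: fM; exists x.
Qed.

Lemma monomial0 (x : 'rV[R]_n) : monomial [ffun=> 0%N] x = 1.
Proof. by rewrite /monomial big1// => j _; rewrite ffunE expr0. Qed.

Lemma is_schwartzM f g : is_schwartz f -> smooth g ->
  (forall s, sorted (fun i j : 'I_n => (i <= j)%N) s ->
    exists2 M : R, 0 <= M & forall x, `|partials s g x| <= M) ->
  is_schwartz (fun x => f x * g x : Rcomplex R).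
Proof.
move=> Sf sg gb; have sf := Sf.1; split; first exact: smoothM.
move=> a b; rewrite /Dmulti.
have [L Ls ->] := partialsM (mindex_word b) sf sg.
suff [M LM] : exists M : R, forall x, `|monomial a x *:
    (\sum_(p <- L) (partials p.1 f x * partials p.2 g x : Rcomplex R))| <= M.
  by exists M => _ [x _ <-]; exact: LM.
elim: L Ls => [_|p L IH /= /andP[/andP[p1 p2] /IH[M LM]]].
  by exists 0 => x; rewrite big_nil scaler0 normr0.
have leT : transitive (fun i j : 'I_n => (i <= j)%N).
  by move=> ? ? ?; exact: leq_trans.
have sb := sorted_mindex_word b.
have [A A0 fA] := is_schwartz_bound (subseq_sorted leT p1 sb) Sf a.
have [B B0 gB] := gb _ (subseq_sorted leT p2 sb).
exists (A * B + M) => x; rewrite big_cons scalerDr.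
apply: le_trans (ler_normD _ _) _; apply: lerD (LM x).
by rewrite scalerAl Rcomplex_normrM; apply: ler_pM.
Qed.

Lemma is_schwartzMs f g : is_schwartz f -> is_schwartz g ->
  is_schwartz (fun x => f x * g x : Rcomplex R).
Proof.
move=> Sf Sg; apply: is_schwartzM => //; first exact: Sg.1.
move=> s ss; have [M M0 gM] := is_schwartz_bound ss Sg [ffun=> 0%N].
by exists M => // x; have := gM x; rewrite monomial0 scale1r.
Qed.

Lemma is_schwartz_cst0 : is_schwartz (cst 0).
Proof.
split; first exact: smooth_cst.
move=> a b; exists 0 => _ [x _ <-]; rewrite /Dmulti partials_cst.
by case: mindex_word => [|? ?]; rewrite /= scaler0 normr0.
Qed.

Lemma is_schwartzD f g : is_schwartz f -> is_schwartz g ->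
  is_schwartz (fun x => f x + g x).
Proof.
move=> Sf Sg; split; first exact: smoothD Sf.1 Sg.1.
move=> a b; have [M fM] := Sf.2 a b; have [N gN] := Sg.2 a b.
exists (M + N) => _ [x _ <-]; rewrite /Dmulti (partialsD _ Sf.1 Sg.1) scalerDr.
apply: le_trans (ler_normD _ _) _.
by apply: lerD; [apply: fM; exists x|apply: gN; exists x].
Qed.

Lemma is_schwartzZ (c : Rcomplex R) f : is_schwartz f ->
  is_schwartz (fun x => c * f x : Rcomplex R).
Proof.
move=> Sf.
have -> : (fun x => c * f x : Rcomplex R) = (fun x => f x * cst c x : Rcomplex R).
  by apply/funext => x; rewrite mulrC.
apply: is_schwartzM => //; first exact: smooth_cst.
move=> s _; exists `|c| => // x; rewrite partials_cst.
by case: s => [|? ?] //=; rewrite normr0.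
Qed.

Lemma is_schwartzX m f : (0 < m)%N -> is_schwartz f ->
  is_schwartz (fun x => (f x : R[i]) ^+ m).
Proof.
case: m => // m _ Sf; elim: m => [|m IH].
  by have -> : (fun x => (f x : R[i]) ^+ 1) = f
    by apply/funext => x; rewrite expr1.
have -> : (fun x => (f x : R[i]) ^+ m.+2) =
    (fun x => f x * ((f x : R[i]) ^+ m.+1 : Rcomplex R) : Rcomplex R).
  by apply/funext => x; rewrite exprS.
exact: is_schwartzMs.
Qed.

End SchwartzFunctions.

Section SchwartzSpace.
Variables (R : realType) (n : nat).

Definition schwartz_fun : {pred 'rV[R]_n -> R[i]} :=
  [pred f : 'rV[R]_n -> R[i] | `[< is_schwartz f >]].

Record schwartz : Type := Schwartz {
  schwartz_val :> 'rV[R]_n -> R[i];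
  schwartz_valP : schwartz_val \in schwartz_fun }.

HB.instance Definition _ := [isSub for schwartz_val].
HB.instance Definition _ := [Choice of schwartz by <:].

Lemma schwartz_submod_closed : submod_closed schwartz_fun.
Proof.
split; first by apply/asboolP; exact: is_schwartz_cst0.
move=> c f g /asboolP Sf /asboolP Sg; apply/asboolP.
exact: is_schwartzD (is_schwartzZ c Sf) Sg.
Qed.

HB.instance Definition _ :=
  GRing.isSubmodClosed.Build R[i] ('rV[R]_n -> R[i]) schwartz_fun
    (GRing.submod_closed_semi schwartz_submod_closed).
HB.instance Definition _ := [SubChoice_isSubLmodule of schwartz by <:].

Definition seminorm (a b : {ffun 'I_n -> nat}) (f : schwartz) : R :=
  sup (range (fun x => `|monomial a x *: Dmulti b f x|)).

Definition seminorms : set (schwartz -> R) :=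
  [set p | exists a b, p = seminorm a b].

Definition seminorm_family (I : {fset schwartz -> R}) : Prop :=
  I != fset0 /\ (forall p, p \in I -> seminorms p).

(* Seminorms are nonnegative, so starting from 0 gives the maximum over [I]. *)
Definition max_seminorm (I : {fset schwartz -> R}) (u : schwartz) : R :=
  \big[Num.max/0]_(p <- I) p u.

End SchwartzSpace.

Section Topology.
Variables (R : realType) (n : nat).
Notation S := (schwartz R n).

Lemma schwartzP (f : S) : is_schwartz f.
Proof. exact/asboolP/schwartz_valP. Qed.

Lemma seminorm0 a b : seminorm a b (0 : S) = 0.
Proof.
rewrite /seminorm; set E := (X in sup X).
have E0 : E = [set 0].
  apply/seteqP; split => [_ [x _ <-]|_ ->] /=.
    rewrite /Dmulti [X in partials _ X](_ : _ = cst 0)// partials_cst.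
    by case: mindex_word => [|? ?]; rewrite /= scaler0 normr0.
  exists 0 => //.
  rewrite /Dmulti [X in partials _ X](_ : _ = cst 0)// partials_cst.
  by case: mindex_word => [|? ?]; rewrite /= scaler0 normr0.
by rewrite E0 sup1.
Qed.

Lemma seminormD a b (f g : S) :
  seminorm a b (f + g) <= seminorm a b f + seminorm a b g.
Proof.
apply: ge_sup; first by exists `|monomial a 0 *: Dmulti b (f + g : S) 0|; exists 0.
move=> _ [x _ <-]; have Sf := schwartzP f; have Sg := schwartzP g.
rewrite /Dmulti [X in partials _ X](_ : _ =
  (fun x => (f x : Rcomplex R) + (g x : Rcomplex R)))//.
rewrite (partialsD _ Sf.1 Sg.1) scalerDr.
apply: le_trans (ler_normD _ _) _; apply: lerD.
  by apply: (ub_le_sup (Sf.2 a b)); exists x.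
by apply: (ub_le_sup (Sg.2 a b)); exists x.
Qed.

Lemma max_seminorm0 (I : {fset S -> R}) : seminorm_family I ->
  max_seminorm I 0 = 0.
Proof.
case=> _ Is; rewrite /max_seminorm big_seq.
by apply: big1_idem => [|p /Is [a [b ->]]]; [exact: maxxx|exact: seminorm0].
Qed.

Lemma max_seminormD (I : {fset S -> R}) (f g : S) : seminorm_family I ->
  max_seminorm I (f + g) <= max_seminorm I f + max_seminorm I g.
Proof.
case=> _ Is; rewrite /max_seminorm big_seq; apply: bigmax_le.
  by apply: addr_ge0; exact: bigmax_ge_id.
move=> p pI; have [a [b pE]] := Is p pI.
apply: (@le_trans _ _ (p f + p g)); first by rewrite pE; exact: seminormD.
by apply: lerD; exact: le_bigmax_seq.
Qed.

Definition schwartz_nbhs (f : S) : set_system S :=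
  [set U | exists I : {fset S -> R}, exists2 d : R,
    seminorm_family I /\ 0 < d &
    [set g | max_seminorm I (g - f) < d] `<=` U].

HB.instance Definition _ := hasNbhs.Build S schwartz_nbhs.

Lemma schwartz_nbhs_singleton (f : S) (U : set S) : nbhs f U -> U f.
Proof.
move=> [I [d [If d0] IU]]; apply: IU => /=.
by rewrite subrr max_seminorm0.
Qed.

Lemma schwartz_nbhs_filter (f : S) : ProperFilter (nbhs f).
Proof.
apply: Build_ProperFilter_ex => [U /schwartz_nbhs_singleton Uf|]; first by exists f.
split.
- pose p : S -> R := seminorm [ffun=> 0%N] [ffun=> 0%N].
  exists [fset p]%fset; exists 1 => //; split=> //; split.
    by apply/fset0Pn; exists p; rewrite inE.
  by move=> q; rewrite inE => /eqP ->; exists [ffun=> 0%N], [ffun=> 0%N].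
- move=> U V [I [d [[I0 If] d0] IU]] [J [e [[J0 Jf] e0] JV]].
  exists (I `|` J)%fset; exists (Num.min d e).
    split; last by rewrite lt_min d0.
    split; last by move=> p; rewrite inE => /orP[/If|/Jf].
    have /fset0Pn[p pI] := I0; apply/fset0Pn; exists p.
    by rewrite inE pI.
  move=> g /=; rewrite lt_min => /andP[gd ge]; split.
    apply: IU; apply: le_lt_trans gd.
    by apply: sub_bigmax_seq => p pI; rewrite inE pI.
  apply: JV; apply: le_lt_trans ge.
  by apply: sub_bigmax_seq => p pI; rewrite inE pI orbT.
- by move=> U V UV [I [d Id IU]]; exists I; exists d => //; exact: subset_trans UV.
Qed.

Lemma schwartz_nbhs_nbhs (f : S) (U : set S) :
  nbhs f U -> nbhs f (nbhs^~ U).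
Proof.
move=> [I [d [If d0] IU]]; exists I; exists d => // g /= gd.
exists I; exists (d - max_seminorm I (g - f)) => [|h /= hd].
  by split=> //; rewrite subr_gt0.
apply: IU => /=; rewrite -[h](subrK g) -addrA.
by apply: le_lt_trans (max_seminormD _ _ If) _; rewrite -ltrBrDr.
Qed.

HB.instance Definition _ := Nbhs_isNbhsTopological.Build S
  schwartz_nbhs_filter schwartz_nbhs_singleton schwartz_nbhs_nbhs.

End Topology.

Section Frechet.
Variables (R : realType) (n : nat).
Notation S := (schwartz R n).

(* The assertion that [A] is a Frechet derivative of [T] at [f]; [A] is not
   claimed to be unique.  Linearity is over [R[i]]. *)
Definition is_frechet_derivative (T : S -> S) (f : S) (A : {linear S -> S}) :=
  continuous A /\
  forall (J : {fset S -> R}) (e : R), seminorm_family J -> 0 < e ->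
  exists I : {fset S -> R}, exists d : R,
    [/\ seminorm_family I, 0 < d & forall u : S,
      (max_seminorm I u = 0 -> max_seminorm J (T (f + u) - T f - A u) = 0) /\
      (0 < max_seminorm I u < d ->
        max_seminorm J
          (((max_seminorm I u)^-1)%:C *: (T (f + u) - T f - A u)) < e)].

Definition frechet_differentiable (T : S -> S) (f : S) :=
  exists A : {linear S -> S}, is_frechet_derivative T f A.

Lemma schwartz_powerP (m : nat) (m_gt0 : (0 < m)%N) (f : S) :
  (fun x => f x ^+ m) \in @schwartz_fun R n.
Proof. by apply/asboolP; apply: is_schwartzX => //; exact: schwartzP. Qed.

Definition schwartz_power (m : nat) (m_gt0 : (0 < m)%N) (f : S) : S :=
  Schwartz (schwartz_powerP m_gt0 f).
End Frechet.

(* Main.v *)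
(* Leibniz' rule makes pointwise multiplication jointly continuous for the
   Schwartz seminorms, so the orders of vanishing [T u = O(|u|^k)] at 0 (each
   target seminorm bounded by finitely many source seminorms) add up under
   products.  The remainder
   [R_m u = (f + u)^m - f^m - m f^(m-1) u] satisfies
   [R_(m+1) u = (f + u) R_m u + u (m f^(m-1) u)], hence is quadratic in [u]. *)
Require Import Defs.
From HB Require Import structures.
From mathcomp Require Import all_boot all_order all_algebra.
From mathcomp Require Import finmap ring.
From mathcomp Require Import all_classical all_reals all_analysis.
From mathcomp Require Import complex.

Set Implicit Arguments.
Unset Strict Implicit.
Unset Printing Implicit Defensive.

Import Order.TTheory GRing.Theory Num.Theory.
Import numFieldNormedType.Exports.

Local Open Scope ring_scope.
Local Open Scope complex_scope.

(** * Quantitative Leibniz rule for iterated partial derivatives *)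

Section Leibniz.
Context {R : realType} {n : nat}.
Implicit Types (f g : 'rV[R]_n -> Rcomplex R) (s t : seq 'I_n).

Lemma partials_rcons s j f : partials (rcons s j) f = partials s (partial j f).
Proof. exact: foldr_rcons. Qed.

Lemma smooth_partial j f : smooth f -> smooth (partial j f).
Proof. by move=> sf s; rewrite -partials_rcons; exact: sf. Qed.

Lemma partialM j f g : smooth f -> smooth g ->
  partial j (fun x => f x * g x : Rcomplex R) =
  fun x => (partial j f x * g x : Rcomplex R) + (f x * partial j g x : Rcomplex R).
Proof.
move=> sf sg; apply: partialE => x; apply: Rcomplex_is_deriveM.
  exact: (smooth_is_derive [::]).
exact: (smooth_is_derive [::]).
Qed.

(** Induction peels off the last letter of [s], the derivative taken first: the product rule then
    leaves two products of smooth functions, to which the induction hypothesis applies with a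
    shorter word. Each letter doubles the number of terms, hence [2 ^+ size s]. The weight [r] is
    carried by [f] alone. *)
Lemma partialsM_le s f g (r M N : R) x : smooth f -> smooth g ->
  (forall t, subseq t s -> `|r *: partials t f x| <= M) ->
  (forall t, subseq t s -> `|partials t g x| <= N) ->
  `|r *: partials s (fun x => f x * g x : Rcomplex R) x| <=
    2 ^+ size s * (M * N).
Proof.
elim/last_ind: s f g => [|s j IH] f g sf sg fM gN.
  by rewrite mul1r /= scalerAl Rcomplex_normrM; apply: ler_pM => //;
    [exact: (fM [::])|exact: (gN [::])].
have sub t : subseq t s -> subseq t (rcons s j).
  by move=> ts; apply: subseq_trans ts (subseq_rcons _ _).
have subj t : subseq t s -> subseq (rcons t j) (rcons s j).
  by move=> ts; rewrite -!cats1 cat_subseq.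
rewrite partials_rcons partialM// partialsD; first last.
- by apply: smoothM => //; exact: smooth_partial.
- by apply: smoothM => //; exact: smooth_partial.
rewrite scalerDr (le_trans (ler_normD _ _))// size_rcons exprS mulr2n !mulrDl mul1r.
apply: lerD; apply: IH => //; try exact: smooth_partial.
- by move=> t ts; rewrite -partials_rcons; exact/fM/subj.
- by move=> t ts; exact/gN/sub.
- by move=> t ts; exact/fM/sub.
- by move=> t ts; rewrite -partials_rcons; exact/gN/subj.
Qed.

Lemma partialsZ s f (c : R) : smooth f ->
  partials s (fun x => c *: f x) = fun x => c *: partials s f x.
Proof.
move=> sf; elim: s => [//|j s IH].
rewrite [LHS]/= -/(partials s _) IH; apply: partialE => x.
by apply: is_deriveZ; exact: smooth_is_derive.
Qed.

End Leibniz.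

(** * Finite families of seminorms and continuity of multiplication *)

Section Seminorms.
Context {R : realType} {n : nat}.
Notation S := (schwartz R n).
Implicit Types (f g h u : S) (I J : {fset S -> R}).

Lemma schwartz_mulP f g : (fun x => f x * g x) \in @schwartz_fun R n.
Proof. by apply/asboolP; apply: is_schwartzMs; exact: schwartzP. Qed.

Definition schwartz_mul f g : S := Schwartz (schwartz_mulP f g).

Lemma schwartz_eqP f g : (forall x, f x = g x) -> f = g.
Proof. by move=> fg; apply/val_inj/funext. Qed.

Lemma le_seminorm a b f x : `|monomial a x *: Dmulti b f x| <= seminorm a b f.
Proof. by apply: (ub_le_sup ((schwartzP f).2 a b)); exists x. Qed.

Lemma seminorm_le a b f M :
  (forall x, `|monomial a x *: Dmulti b f x| <= M) -> seminorm a b f <= M.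
Proof.
move=> fM; apply: ge_sup => [|_ [x _ <-]//].
by exists `|monomial a 0 *: Dmulti b f 0|; exists 0.
Qed.

Lemma seminormZ_le a b (c : R) f : 0 <= c ->
  seminorm a b (c%:C *: f) <= c * seminorm a b f.
Proof.
move=> c0; apply: seminorm_le => x; rewrite /Dmulti.
(* Scaling in [S] is complex multiplication by [c%:C]; componentwise it is the real scaling of
   [Rcomplex R], with which derivatives commute. *)
rewrite [X in partials _ X](_ : _ = fun y => c *: (f y : Rcomplex R)); last first.
  apply/funext => y /=; rewrite /GRing.scale /=; case: (f y) => p q /=.
  by congr (_ +i* _); rewrite mul0r ?subr0 ?addr0.
rewrite partialsZ; last exact: (schwartzP f).1.
by rewrite scalerA mulrC -scalerA normrZ ger0_norm// ler_wpM2l// le_seminorm.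
Qed.

Lemma max_seminorm_ge0 I u : 0 <= max_seminorm I u.
Proof. exact: bigmax_ge_id. Qed.

Lemma le_max_seminorm I p u : p \in I -> p u <= max_seminorm I u.
Proof. by move=> pI; exact: le_bigmax_seq. Qed.

Lemma max_seminorm_le I u M : 0 <= M -> (forall p, p \in I -> p u <= M) ->
  max_seminorm I u <= M.
Proof. by move=> M0 IM; rewrite /max_seminorm big_seq; exact: bigmax_le. Qed.

Lemma max_seminormUl I J u : max_seminorm I u <= max_seminorm (I `|` J)%fset u.
Proof. by apply: sub_bigmax_seq => p pI; rewrite inE pI. Qed.

Lemma max_seminormUr I J u : max_seminorm J u <= max_seminorm (I `|` J)%fset u.
Proof. by rewrite fsetUC; exact: max_seminormUl. Qed.

Lemma seminorm_familyU I J : seminorm_family I -> seminorm_family J ->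
  seminorm_family (I `|` J)%fset.
Proof.
move=> [/fset0Pn[p pI] Is] [_ Js]; split.
  by apply/fset0Pn; exists p; rewrite inE pI.
by move=> q; rewrite inE => /orP[/Is|/Js].
Qed.

Lemma max_seminormZ_le I (c : R) u : seminorm_family I -> 0 <= c ->
  max_seminorm I (c%:C *: u) <= c * max_seminorm I u.
Proof.
move=> [_ Is] c0; apply: max_seminorm_le => [|p pI].
  by rewrite mulr_ge0// max_seminorm_ge0.
apply: le_trans (ler_wpM2l c0 (le_max_seminorm u pI)).
by have [a [b ->]] := Is _ pI; exact: seminormZ_le.
Qed.

Lemma seminormM_le a b : exists I, exists2 C : R, seminorm_family I /\ 0 <= C &
  forall f g, seminorm a b (schwartz_mul f g) <=
    C * (max_seminorm I f * max_seminorm I g).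
Proof.
pose s := mindex_word b.
pose z : {ffun 'I_n -> nat} := [ffun=> 0%N].
pose index (t : seq 'I_n) : {ffun 'I_n -> nat} := [ffun j => count_mem j t].
(* Weights [a] (for [f]) and [z] (for [g]), derivatives along all subwords of [s]; the boolean masks
   of length [size s] enumerate these subwords. *)
pose I := [fset p in [seq (seminorm c (index t) : S -> R) | c <- [:: a; z],
  t <- [seq mask (val k) s | k : (size s).-tuple bool]]]%fset.
have inI c t : c \in [:: a; z] -> subseq t s -> seminorm c (index t) \in I.
  move=> ca /subseqP[k ks ->]; rewrite in_fset.
  apply: allpairs_f => //; apply/mapP.
  by move/eqP: ks => ks; exists (Tuple ks); rewrite ?mem_enum.
(* A subword of a sorted word is sorted, hence is the canonical word of its letter counts; its
   partial derivative is thus a [Dmulti], controlled by a seminorm. *)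
have tE t : subseq t s -> t = mindex_word (index t).
  move=> ts; apply/sorted_mindexP/(subseq_sorted _ ts (sorted_mindex_word b)).
  by move=> ? ? ?; exact: leq_trans.
exists I; exists (2 ^+ size s).
  split=> //; split; first by apply/fset0Pn; exists (seminorm a (index [::]));
    apply: inI; rewrite ?inE ?eqxx ?sub0seq.
  by move=> p; rewrite in_fset => /allpairsP[[c t] [_ _ ->]]; exists c, (index t).
move=> f g; apply: seminorm_le => x; apply: partialsM_le.
- exact: (schwartzP f).1.
- exact: (schwartzP g).1.
- move=> t ts; apply: le_trans (le_max_seminorm _ (inI a t _ ts)).
    by rewrite {1}(tE _ ts) le_seminorm.
  by rewrite inE eqxx.
- move=> t ts; apply: le_trans (le_max_seminorm _ (inI z t _ ts)).
    by have := le_seminorm z (index t) g x; rewrite monomial0 scale1r /Dmulti -tE.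
  by rewrite !inE eqxx orbT.
Qed.

Lemma max_seminormM_le J : seminorm_family J ->
  exists I, exists2 C : R, seminorm_family I /\ 0 <= C &
  forall f g, max_seminorm J (schwartz_mul f g) <=
    C * (max_seminorm I f * max_seminorm I g).
Proof.
move=> [_ Js].
(* Induction on the list underlying [J]: adding a seminorm enlarges the family by a union and the
   constant by a sum. The empty list still needs some nonempty family, so the base case takes an
   arbitrary one. *)
suff [I [C [If C0] IC]] : exists I, exists2 C : R, seminorm_family I /\ 0 <= C &
    forall p, p \in enum_fset J -> forall f g,
    p (schwartz_mul f g) <= C * (max_seminorm I f * max_seminorm I g).
  exists I; exists C => // f g; apply: max_seminorm_le => [|p /IC//].
  by rewrite !mulr_ge0// max_seminorm_ge0.
have : forall p, p \in enum_fset J -> seminorms p := Js.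
elim: (enum_fset J) => [_|p l IH ls].
  have [I [C IC _]] := seminormM_le [ffun=> 0%N] [ffun=> 0%N].
  by exists I; exists C.
have [q ql|I [C [If C0] IC]] := IH; first by apply: ls; rewrite inE ql orbT.
have [a [b pE]] := ls p (mem_head _ _).
have [K [D [Kf D0] KD]] := seminormM_le a b.
exists (I `|` K)%fset; exists (C + D).
  by split; [exact: seminorm_familyU|exact: addr_ge0].
move=> q; rewrite inE => /orP[/eqP ->|/IC{}IC] f g.
  rewrite pE (le_trans (KD _ _))// ler_pM ?mulr_ge0 ?max_seminorm_ge0 ?lerDr//.
  by rewrite ler_pM ?max_seminorm_ge0 ?max_seminormUr.
rewrite (le_trans (IC _ _))// ler_pM ?mulr_ge0 ?max_seminorm_ge0 ?lerDl//.
by rewrite ler_pM ?max_seminorm_ge0 ?max_seminormUl.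
Qed.

End Seminorms.

(** * Order of vanishing at the origin, and differentiability from order two *)

Section OrderAtZero.
Context {R : realType} {n : nat}.
Notation S := (schwartz R n).
Implicit Types (f u : S) (I J : {fset S -> R}) (T U : S -> S).

(** The bound is asked only on the unit ball of [max_seminorm I], where higher powers are dominated
    by lower ones, so that orders can be lowered. *)
Definition order_at_zero (k : nat) T := forall J, seminorm_family J ->
  exists I, exists2 C : R, seminorm_family I /\ 0 <= C &
  forall u, max_seminorm I u <= 1 ->
    max_seminorm J (T u) <= C * max_seminorm I u ^+ k.

Lemma order_at_zero_id : order_at_zero 1 id.
Proof. by move=> J Jf; exists J; exists 1 => // u _; rewrite mul1r. Qed.

Lemma order_at_zero_cst f : order_at_zero 0 (fun=> f).
Proof.
move=> J Jf; exists J; exists (max_seminorm J f) => [|u _].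
  by split=> //; exact: max_seminorm_ge0.
by rewrite mulr1.
Qed.

Lemma order_at_zero0 k : order_at_zero k (fun=> 0).
Proof.
by move=> J Jf; exists J; exists 0 => // u _; rewrite mul0r max_seminorm0.
Qed.

Lemma order_at_zeroW k l T : (l <= k)%N -> order_at_zero k T -> order_at_zero l T.
Proof.
move=> lk Tk J /Tk[I [C [If C0] IC]]; exists I; exists C => // u u1.
rewrite (le_trans (IC u u1))// ler_wpM2l// ler_wiXn2l//.
exact: max_seminorm_ge0.
Qed.

Lemma order_at_zeroD k T U : order_at_zero k T -> order_at_zero k U ->
  order_at_zero k (fun u => T u + U u).
Proof.
move=> Tk Uk J Jf; have [I [C [If C0] IC]] := Tk _ Jf.
have [K [D [Kf D0] KD]] := Uk _ Jf.
exists (I `|` K)%fset; exists (C + D) => [|u u1].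
  by split; [exact: seminorm_familyU|exact: addr_ge0].
(* The unit ball of the union lies in the unit balls of [I] and [K], so both bounds apply. *)
have uI := max_seminormUl I K u; have uK := max_seminormUr I K u.
rewrite (le_trans (max_seminormD _ _ Jf))// mulrDl lerD//.
- rewrite (le_trans (IC _ (le_trans uI u1)))// ler_wpM2l//.
  by rewrite lerXn2r ?nnegrE ?max_seminorm_ge0.
- rewrite (le_trans (KD _ (le_trans uK u1)))// ler_wpM2l//.
  by rewrite lerXn2r ?nnegrE ?max_seminorm_ge0.
Qed.

Lemma order_at_zeroM k l T U : order_at_zero k T -> order_at_zero l U ->
  order_at_zero (k + l) (fun u => schwartz_mul (T u) (U u)).
Proof.
move=> Tk Ul J /max_seminormM_le[H [B [Hf B0] HB]].
have [I [C [If C0] IC]] := Tk _ Hf; have [K [D [Kf D0] KD]] := Ul _ Hf.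
exists (I `|` K)%fset; exists (B * (C * D)) => [|u u1].
  by split; [exact: seminorm_familyU|rewrite !mulr_ge0].
have uI := max_seminormUl I K u; have uK := max_seminormUr I K u.
rewrite (le_trans (HB _ _))// -mulrA ler_wpM2l// exprD mulrACA.
apply: ler_pM; try exact: max_seminorm_ge0.
- rewrite (le_trans (IC _ (le_trans uI u1)))// ler_wpM2l//.
  by rewrite lerXn2r ?nnegrE ?max_seminorm_ge0.
- rewrite (le_trans (KD _ (le_trans uK u1)))// ler_wpM2l//.
  by rewrite lerXn2r ?nnegrE ?max_seminorm_ge0.
Qed.

Lemma mulr_lt_of_small (C e : R) : 0 <= C -> 0 < e ->
  exists2 d : R, 0 < d <= 1 & forall t : R, 0 <= t < d -> C * t < e.
Proof.
move=> C0 e0; have C1 : 0 < C + 1 by rewrite ltr_wpDl.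
(* The denominator [C + 1] stays positive when [C] is 0; the cap at 1 keeps later arguments in the
   unit ball. *)
exists (Num.min 1 (e / (C + 1))).
  by rewrite lt_min ltr01 divr_gt0// ge_min lexx.
move=> t /andP[t0]; rewrite lt_min ltr_pdivlMr// => /andP[_].
by apply: le_lt_trans; rewrite mulrDr mulr1 mulrC lerDl.
Qed.

Lemma order1_linear_continuous (A : {linear S -> S}) :
  order_at_zero 1 A -> continuous A.
Proof.
move=> A1 f V [J [e [Jf e0] JV]]; have [I [C [If C0] IC]] := A1 _ Jf.
have [d /andP[d0 d1] dC] := mulr_lt_of_small C0 e0.
exists I; exists d => // g /= gd; apply: JV => /=; rewrite -linearB.
apply: le_lt_trans (IC _ (le_trans (ltW gd) d1)) _; rewrite expr1; apply: dC.
by rewrite max_seminorm_ge0.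
Qed.

(** Dividing a quadratic bound by [max_seminorm I u] leaves a linear one, which is small near 0;
    where [max_seminorm I u] vanishes, the quadratic bound itself is 0. *)
Lemma order2_is_frechet_derivative T f (A : {linear S -> S}) :
  order_at_zero 1 A -> order_at_zero 2 (fun u => T (f + u) - T f - A u) ->
  is_frechet_derivative T f A.
Proof.
move=> A1 T2; split; first exact: order1_linear_continuous.
move=> J e Jf e0; have [I [C [If C0] IC]] := T2 _ Jf.
have [d /andP[d0 d1] dC] := mulr_lt_of_small C0 e0.
exists I, d; split=> // u; split.
  move=> u0; apply/eqP; rewrite eq_le max_seminorm_ge0 andbT.
  by rewrite (le_trans (IC u _)) ?u0 ?ler01// expr0n mulr0.
move=> /andP[u0 ud].
apply: le_lt_trans (max_seminormZ_le _ Jf _) _; first by rewrite invr_ge0 ltW.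
apply: le_lt_trans (_ : C * max_seminorm I u < e); last by rewrite dC// ltW.
rewrite mulrC ler_pdivrMr// -mulrA -expr2.
exact/IC/(le_trans (ltW ud) d1).
Qed.

End OrderAtZero.

(** * The derivative of the power operator and its remainder *)

Section Power.
Context {R : realType} {n : nat}.
Notation S := (schwartz R n).
Implicit Types (f u : S) (m : nat).

Lemma power_derivativeP m f u : (0 < m)%N ->
  (fun x => m%:R * f x ^+ (m - 1) * u x) \in @schwartz_fun R n.
Proof.
(* The case [m = 1] is separate: [f x ^+ 0] is the constant 1, which is not a Schwartz function, so
   the formula is then not a product of Schwartz functions. *)
case: m => [//|[|m] _].
  rewrite [X in X \in _](_ : _ = u :> (_ -> _)); first exact: schwartz_valP.
  by apply/funext => x; rewrite mul1r expr0 mul1r.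
rewrite [X in X \in _](_ : _ =
  m.+2%:R *: schwartz_mul (schwartz_power (ltn0Sn m) f) u :> (_ -> _)).
  exact: schwartz_valP.
by apply/funext => x; rewrite subn1 -mulrA.
Qed.

Definition power_derivative m (m_gt0 : (0 < m)%N) f u : S :=
  Schwartz (power_derivativeP f u m_gt0).

Lemma power_derivative_is_linear m (m_gt0 : (0 < m)%N) f :
  linear (power_derivative m_gt0 f).
Proof.
by move=> c u v; apply: schwartz_eqP => x /=; rewrite mulrDr mulrCA.
Qed.

HB.instance Definition _ m (m_gt0 : (0 < m)%N) f :=
  GRing.isLinear.Build R[i] S S *:%R (power_derivative m_gt0 f)
    (power_derivative_is_linear m_gt0 f).

Lemma power_derivative_order m (m_gt0 : (0 < m)%N) f :
  order_at_zero 1 (power_derivative m_gt0 f).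
Proof.
case: m m_gt0 => [//|[|m]] m_gt0.
  rewrite [power_derivative _ _](_ : _ = id); first exact: order_at_zero_id.
  apply/funext => u; apply: schwartz_eqP => x /=.
  by rewrite mul1r expr0 mul1r.
(* The scalar joins the fixed factor, of order 0; the factor [u] contributes order 1. *)
rewrite [power_derivative _ _](_ : _ = fun u =>
    schwartz_mul (m.+2%:R *: schwartz_power (ltn0Sn m) f) u).
  exact: (order_at_zeroM (order_at_zero_cst _) order_at_zero_id).
by apply/funext => u; apply: schwartz_eqP => x /=; rewrite subn1.
Qed.

Lemma power_remainder_order m (m_gt0 : (0 < m)%N) f : order_at_zero 2 (fun u =>
  schwartz_power m_gt0 (f + u) - schwartz_power m_gt0 f - power_derivative m_gt0 f u).
Proof.
case: m m_gt0 => [//|m]; elim: m => [|m IH] m_gt0.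
  set T := (X in order_at_zero _ X).
  rewrite [T](_ : _ = fun=> 0); first exact: order_at_zero0.
  apply/funext => u; apply: schwartz_eqP => x.
  by rewrite -[LHS]/((f x + u x) ^+ 1 - f x ^+ 1 - 1 * f x ^+ 0 * u x); ring.
pose Rm u := schwartz_power (ltn0Sn m) (f + u) - schwartz_power (ltn0Sn m) f -
  power_derivative (ltn0Sn m) f u.
set T := (X in order_at_zero _ X).
rewrite [T](_ : _ = fun u => schwartz_mul (f + u) (Rm u) +
    schwartz_mul u (power_derivative (ltn0Sn m) f u)).
  (* Both summands have order 2: as 0 + 2 for [f + u] times [Rm u], and as 1 + 1 for [u] times the
     derivative. *)
  apply: order_at_zeroD.
    apply: (@order_at_zeroM _ _ 0 2); last exact: IH.
    apply: order_at_zeroD; first exact: order_at_zero_cst.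
    exact: order_at_zeroW order_at_zero_id.
  exact: (order_at_zeroM order_at_zero_id (power_derivative_order _ _)).
apply/funext => u; apply: schwartz_eqP => x.
rewrite -[LHS]/((f x + u x) ^+ m.+2 - f x ^+ m.+2 -
  m.+2%:R * f x ^+ (m.+2 - 1) * u x).
rewrite -[RHS]/((f x + u x) * ((f x + u x) ^+ m.+1 - f x ^+ m.+1 -
  m.+1%:R * f x ^+ (m.+1 - 1) * u x) +
  u x * (m.+1%:R * f x ^+ (m.+1 - 1) * u x)).
(* Every power is expressed through [m]-th powers, leaving a polynomial identity. *)
rewrite !subn1 /= !(exprS _ m.+1) -(natr1 m.+1) !(exprS _ m); ring.
Qed.

End Power.

Theorem theorem5p8 (R : realType) (n m : nat)
    (n_gt0 : (0 < n)%N) (m_gt0 : (0 < m)%N) :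
  (forall f : schwartz R n, frechet_differentiable (schwartz_power m_gt0) f) /\
  (forall f : schwartz R n,
    exists2 A : {linear schwartz R n -> schwartz R n},
      is_frechet_derivative (schwartz_power m_gt0) f A &
      (m = 1%N -> forall u : schwartz R n, A u = u) /\
      ((1 < m)%N ->
        (f = 0 -> forall u : schwartz R n, A u = 0) /\
        (f <> 0 -> forall (u : schwartz R n) (x : 'rV[R]_n),
          A u x = m%:R * f x ^+ (m - 1) * u x))).
Proof.
have dP f : is_frechet_derivative (schwartz_power m_gt0) f (power_derivative m_gt0 f).
  apply: order2_is_frechet_derivative; first exact: power_derivative_order.
  exact: power_remainder_order.
split=> f; first by exists (power_derivative m_gt0 f).
exists (power_derivative m_gt0 f) => //; split=> [m1 u|m1].
  by apply: schwartz_eqP => x /=; rewrite m1 mul1r expr0 mul1r.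
split=> [-> u|//]; apply: schwartz_eqP => x /=.
(* Since [1 < m], the exponent [m - 1] is nonzero and [0 ^+ (m - 1)] vanishes. *)
by rewrite expr0n subn_eq0 leqNgt m1 mulr0 mul0r.
Qed.
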